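(* For all real numbers $[a],[b],[c]\in\mathcal{S}_{\mathbb{R}}$ such that $[a]\le[b]$ we have $[a]+[c]\le[b]+[c]$.
   Context: Conventions. $\omega=\{0,1,2,\dots\}$, $\omega_+=\omega\setminus\{0\}$, $[a,b]_\omega=\{n\in\omega:a\le n\le b\}$, $[a,\infty]_\omega=\{n\in\omega:n\ge a\}$. A system function $\vartheta:\omega_+\to[2,\infty]_\omega$ is fixed. Contractions. For $f:\omega\to\omega$ and $n\in\omega_+$, the contraction $c_n$ is applicable to $f$ iff $f(n+1)\ge\vartheta(n)$, and then $c_n(f)(n)=f(n)+1$, $c_n(f)(n+1)=f(n+1)-\vartheta(n)$, $c_n(f)(k)=f(k)$ for other $k$. A sequence of contractions is a finite (possibly empty) composition of contractions; it is applicable to $f$ iff each contraction in turn is applicable to the result of the preceding ones. Sign. For $f:\omega\to\omega$, $\sigma(f)=0$ if $f(0)$ is odd and $\sigma(f)=1$ if $f(0)$ is even. Auxiliary functions. $h:\omega\to\omega$ is a primary auxiliary function ($h\in A_p$) if $h(k)<\vartheta(k-1)$ for all $k\ge2$ and for every $N\in\omega_+$ there is $M\ge N+1$ with $h(M)\ne\vartheta(M-1)-1$. It is a secondary auxiliary function ($h\in A_s$) if $h(k)<\vartheta(k-1)$ for all $k\ge2$ and there is $N\in\omega_+$ with $h(M)=\vartheta(M-1)-1$ for all $M\ge N+1$; the least such $N$ is $N^h_{\min}$. Base set. $W_1$ is the set of pairs $(h_p,h_s)\in A_p\times A_s$ such that, with $N=N^{h_s}_{\min}$, $h_p(k)=h_s(k)$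 for $k<N$, $h_p(N)=h_s(N)+1$, and $h_p(k)=0$ for $k>N$. Two pairs in $W_1$ are equivalent if their first components agree on $\omega_+$ and have the same sign; $F$ is the collection of sets obtained by taking, for each equivalence class, the set of all functions that are components of its pairs. $W_2$ is the set of primary auxiliary functions occurring in no pair of $W_1$; two elements of $W_2$ are equivalent if they agree on $\omega_+$ and have the same sign; $G_2$ is the set of equivalence classes. The base set is $B=F\cup G_2$. Real numbers. For $b\in B$, $r_b$ is the set of $f:\omega\to\omega$ for which there is $h\in b$ such that for every $N\in\omega_+$ some sequence of contractions $\mathcal{C}$ applicable to $f$ satisfies $\mathcal{C}(f)(n)=h(n)$ for all $n\in[0,N]_\omega$. Let $b_1,b_2\in B$ be the elements containing respectively the zero function, and the function with value $1$ at $0$ and $0$ elsewhere. $\mathcal{S}_{\mathbb{R}}$ (the set of real numbers) consists of all $r_b$ with $b\in B\setminus\{b_1,b_2\}$ together with $[0]:=r_{b_1}\cup r_{b_2}$. Put $\mathcal{S}_{\mathbb{R}}^*=\mathcal{S}_{\mathbb{R}}\setminus\{[0]\}$. Distinct real numbers are disjoint. A function lying in some real number is called finite, and $[f]$ denotes the real number containing $f$. For $[a]\in\mathcal{S}_{\mathbb{R}}^*$ all elements have the same sign, denoted $\sigma([a])$. Every real number $[x]$ contains primary auxiliary functions, and they all agree on $\omega_+$; $x_p$ denotes one of them. Order. For $[a],[b]\in\mathcal{S}_{\mathbb{R}}^*$, $[a]\le[b]$ iff one of the following holds: (i) $\sigma([a])<\sigma([b])$; (ii) $\sigma([a])=\sigma([b])=1$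 and for every $a\in[a]$ there is $b\in[b]$ with $a(n)\le b(n)$ for all $n\in\omega_+$; (iii) $\sigma([a])=\sigma([b])=0$ and for every $b\in[b]$ there is $a\in[a]$ with $a(n)\ge b(n)$ for all $n\in\omega_+$. For $[a]\in\mathcal{S}_{\mathbb{R}}^*$, $[a]\le[0]$ iff $\sigma([a])=0$, and $[0]\le[a]$ iff $\sigma([a])=1$. Finally $[0]\le[0]$ holds. Strict order: $[a]<[b]$ iff not $[b]\le[a]$. Addition. The absolute value $|f|$ of $f:\omega\to\omega$ is the function with $|f|(0)=0$ and $|f|(k)=f(k)$ for $k\in\omega_+$; for a real number, $|[x]|:=[|f|]$ for any $f\in[x]$ (independent of $f$). For finite $f,g$ with $|[f]|>|[g]|$, the set of tracking functions $\mathcal{T}^f_g$ consists of all $\varrho:\omega\to\omega$ for which there is $w\in[f]$ with $w(n)\ge g(n)$ for all $n\in\omega_+$, $\varrho(0)=w(0)$ and $\varrho(n)=w(n)-g(n)$ for all $n\in\omega_+$. If moreover $\sigma(f)\ne\sigma(g)$ or $g\in[0]$, then $\mathcal{T}^f_g$ is non-empty and contained in a single real number $[x]$, and the primary tracking function $\varrho^f_g$ is defined by $\varrho^f_g(0)=f(0)$, $\varrho^f_g(k)=x_p(k)$ for $k\in\omega_+$. For finite $f,g$ the sub-sum $f+g:\omega\to\omega$ is: if $\sigma(f)=\sigma(g)$ and $f,g\notin[0]$, then $(f+g)(0)=f(0)g(0)$ and $(f+g)(k)=f(k)+g(k)$ for $k\in\omega_+$; otherwise $f+g$ is the zero function if $|[f]|=|[g]|$,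 is $\varrho^f_g$ if $|[f]|>|[g]|$, and is $\varrho^g_f$ if $|[f]|<|[g]|$. Addition of real numbers: $[f]+[g]:=[f+g]$ for any $f\in[f]$, $g\in[g]$ (independent of the choice of representatives). *)

(* Defs.v *)
From HB Require Import structures.
From mathcomp Require Import all_boot.
From mathcomp Require Import boolp classical_sets.

Set Implicit Arguments.
Unset Strict Implicit.
Unset Printing Implicit Defensive.

Local Open Scope classical_set_scope.

(* A system function is only meaningful on positive arguments: [theta 0] is
   never consulted below. *)
Definition system_function (theta : nat -> nat) : Prop :=
  forall n, 0 < n -> 2 <= theta n.

Definition contraction_applicable (theta : nat -> nat) (n : nat)
  (f : nat -> nat) : bool := (0 < n) && (theta n <= f n.+1).

Definition contraction (theta : nat -> nat) (n : nat) (f : nat -> nat) :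
    nat -> nat :=
  fun k => if k == n then f n + 1
           else if k == n.+1 then f n.+1 - theta n
           else f k.

(* A sequence of contractions is given by the list of its indices; the head of
   the list is the contraction performed first. *)
Fixpoint contractions_applicable (theta : nat -> nat) (s : seq nat)
    (f : nat -> nat) : bool :=
  if s is n :: s' then
    contraction_applicable theta n f
    && contractions_applicable theta s' (contraction theta n f)
  else true.

Fixpoint contractions (theta : nat -> nat) (s : seq nat) (f : nat -> nat) :
    nat -> nat :=
  if s is n :: s' then contractions theta s' (contraction theta n f) else f.

Definition sgn (f : nat -> nat) : nat := if odd (f 0) then 0 else 1.

Definition bounded_digits (theta h : nat -> nat) : Prop :=
  forall k, 2 <= k -> h k < theta k.-1.

Definition maximal_after (theta h : nat -> nat) (N : nat) : Prop :=
  forall M, N.+1 <= M -> h M = theta M.-1 - 1.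

Definition primary (theta : nat -> nat) : set (nat -> nat) :=
  [set h | bounded_digits theta h /\
           forall N, 0 < N ->
             exists M, N.+1 <= M /\ h M <> theta M.-1 - 1].

Definition secondary (theta : nat -> nat) : set (nat -> nat) :=
  [set h | bounded_digits theta h /\
           exists N, 0 < N /\ maximal_after theta h N].

Definition is_Nmin (theta h : nat -> nat) (N : nat) : Prop :=
  [/\ 0 < N, maximal_after theta h N &
      forall N', 0 < N' -> maximal_after theta h N' -> N <= N'].

Definition W1 (theta : nat -> nat) : set ((nat -> nat) * (nat -> nat)) :=
  [set p | [/\ primary theta p.1, secondary theta p.2 &
      exists N, [/\ is_Nmin theta p.2 N,
                    forall k, k < N -> p.1 k = p.2 k,
                    p.1 N = p.2 N + 1 &
                    forall k, N < k -> p.1 k = 0]]].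

Definition base_equiv (f g : nat -> nat) : Prop :=
  (forall k, 0 < k -> f k = g k) /\ sgn f = sgn g.

Definition base_F (theta : nat -> nat) : set (set (nat -> nat)) :=
  [set b | exists2 p, W1 theta p &
     b = [set h | exists q, [/\ W1 theta q, base_equiv p.1 q.1 &
                               h = q.1 \/ h = q.2]]].

Definition W2 (theta : nat -> nat) : set (nat -> nat) :=
  [set h | primary theta h /\
           ~ exists p, W1 theta p /\ (h = p.1 \/ h = p.2)].

Definition base_G2 (theta : nat -> nat) : set (set (nat -> nat)) :=
  [set b | exists2 h, W2 theta h &
     b = [set h' | W2 theta h' /\ base_equiv h h']].

Definition base (theta : nat -> nat) : set (set (nat -> nat)) :=
  base_F theta `|` base_G2 theta.

Definition real_of_base (theta : nat -> nat) (b : set (nat -> nat)) :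
    set (nat -> nat) :=
  [set f | exists2 h, b h &
     forall N, 0 < N ->
       exists s, contractions_applicable theta s f /\
                 forall n, n <= N -> contractions theta s f n = h n].

(* Here and below [xget x0 P] plays the role of a definite description: it is
   only used where [P] has exactly one element, or where the choice of the
   element of [P] is irrelevant, and then the default value [x0] is not
   reached. *)
Definition base_elt (theta h : nat -> nat) : set (nat -> nat) :=
  xget set0 [set b | base theta b /\ b h].

Definition zero_fun : nat -> nat := fun=> 0.
Definition one_at0 : nat -> nat := fun n => if n == 0 then 1 else 0.

Definition b1 (theta : nat -> nat) := base_elt theta zero_fun.
Definition b2 (theta : nat -> nat) := base_elt theta one_at0.

Definition real0 (theta : nat -> nat) : set (nat -> nat) :=
  real_of_base theta (b1 theta) `|` real_of_base theta (b2 theta).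

(* A real number is a set of functions; [reals theta] is the set of all of
   them. *)
Definition reals (theta : nat -> nat) : set (set (nat -> nat)) :=
  [set x | (exists b, [/\ base theta b, b <> b1 theta, b <> b2 theta &
                         x = real_of_base theta b])
           \/ x = real0 theta].

(* [f], for finite f *)
Definition class_of (theta f : nat -> nat) : set (nat -> nat) :=
  xget set0 [set x | reals theta x /\ x f].

Definition sgn_real (x : set (nat -> nat)) : nat := xget 0 (sgn @` x).

Definition real_le (theta : nat -> nat) (x y : set (nat -> nat)) : Prop :=
  [\/ [/\ x <> real0 theta, y <> real0 theta &
        [\/ sgn_real x < sgn_real y,
            [/\ sgn_real x = 1, sgn_real y = 1 &
              forall f, x f -> exists g, y g /\
                forall n, 0 < n -> f n <= g n] |
            [/\ sgn_real x = 0, sgn_real y = 0 &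
              forall g, y g -> exists f, x f /\
                forall n, 0 < n -> f n >= g n]]],
      [/\ x <> real0 theta, y = real0 theta & sgn_real x = 0],
      [/\ x = real0 theta, y <> real0 theta & sgn_real y = 1] |
      x = real0 theta /\ y = real0 theta].

Definition real_lt (theta : nat -> nat) (x y : set (nat -> nat)) : Prop :=
  ~ real_le theta y x.

Definition abs_fun (f : nat -> nat) : nat -> nat :=
  fun k => if k == 0 then 0 else f k.

Definition real_abs (theta : nat -> nat) (x : set (nat -> nat)) :
    set (nat -> nat) :=
  xget set0 [set class_of theta (abs_fun f) | f in x].

Definition tracking (theta f g : nat -> nat) : set (nat -> nat) :=
  [set r | exists w, [/\ class_of theta f w,
                         forall n, 0 < n -> w n >= g n,
                         r 0 = w 0 &
                         forall n, 0 < n -> r n = w n - g n]].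

Definition primary_repr (theta : nat -> nat) (x : set (nat -> nat)) :
    nat -> nat :=
  xget zero_fun (x `&` primary theta).

Definition primary_tracking (theta f g : nat -> nat) : nat -> nat :=
  let x := xget set0 [set x | reals theta x /\ tracking theta f g `<=` x] in
  fun k => if k == 0 then f 0 else primary_repr theta x k.

(* The order on real numbers being total, the last branch is the case
   |[f]| < |[g]|. *)
Definition sub_sum (theta f g : nat -> nat) : nat -> nat :=
  let af := real_abs theta (class_of theta f) in
  let ag := real_abs theta (class_of theta g) in
  if `[< [/\ sgn f = sgn g, ~ real0 theta f & ~ real0 theta g] >] then
    fun k => if k == 0 then f 0 * g 0 else f k + g k
  else if `[< af = ag >] then zero_fun
  else if `[< real_lt theta ag af >] then primary_tracking theta f g
  else primary_tracking theta g f.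

Definition real_add (theta : nat -> nat) (x y : set (nat -> nat)) :
    set (nat -> nat) :=
  xget set0 [set class_of theta (sub_sum theta f g) | f in x & g in y].

(* Main.v *)
(** A function [f] stands for the series [f 1 + f 2 / theta 1 + f 3 / (theta 1 * theta 2) + ...] with the
    sign carried by the parity of [f 0].  Contractions preserve its sum, and [f] can be contracted towards
    a primary or secondary auxiliary function [h] exactly when both series have the same finite sum: [f]
    reaches the primary expansion when its partial sums attain the sum, and the secondary one when they
    do not.  Hence the sets of the construction are the fibres of a bijection onto an ordinary
    field of real numbers that respects order and addition, where the claim is translation invariance. *)

Require Import Defs.
From mathcomp Require Import all_boot.
From mathcomp Require Import boolp classical_sets.
From mathcomp Require Import order ssralg ssrnum archimedean reals Rstruct.
From mathcomp Require Import lra zify.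

Set Implicit Arguments.
Unset Strict Implicit.
Unset Printing Implicit Defensive.

Import Order.TTheory GRing.Theory Num.Theory.

(** * Mixed-radix mantissas and the effect of contractions on them *)

Section Contractions.
Variable theta : nat -> nat.
Hypothesis theta_ge2 : system_function theta.

(** The digit at place [n] has weight [1 / radix n]; both [radix 0] and [radix 1] are the empty
    product 1. *)
Definition radix (n : nat) : nat := \prod_(1 <= i < n) theta i.

(* [mantissa f n] is the sum of the [f k / radix k] for [1 <= k <= n], scaled by
   [radix n]; the meaningless [theta 0] only ever multiplies [0]. *)
Fixpoint mantissa (f : nat -> nat) (n : nat) : nat :=
  if n is m.+1 then theta m * mantissa f m + f m.+1 else 0.

Lemma mantissaS f n : mantissa f n.+1 = theta n * mantissa f n + f n.+1.
Proof. by []. Qed.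

Lemma theta_gt0 n : 0 < n -> 0 < theta n.
Proof. by move=> /theta_ge2; case: (theta n). Qed.

Lemma radixS n : 0 < n -> radix n.+1 = radix n * theta n.
Proof. by move=> n0; rewrite /radix big_nat_recr. Qed.

Lemma radix_gt0 n : 0 < radix n.
Proof.
elim: n => [|[|n] IHn]; do 1?by rewrite /radix big_geq.
by rewrite radixS // muln_gt0 IHn theta_gt0.
Qed.

Lemma leq_radix n : n <= radix n.
Proof.
elim: n => [|[|n] IHn] //; first by rewrite /radix big_geq.
by rewrite radixS //; have := @theta_ge2 n.+1 isT; nia.
Qed.

Lemma eq_mantissa f g n :
  (forall k, 0 < k <= n -> f k = g k) -> mantissa f n = mantissa g n.
Proof.
elim: n => [//|n IHn] fg /=; rewrite fg ?leqnn // IHn // => k /andP[k0 kn].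
by apply: fg; rewrite k0 leqW.
Qed.

Lemma mantissa_contraction_lt n f k : k < n ->
  mantissa (contraction theta n f) k = mantissa f k.
Proof.
move=> kn; apply: eq_mantissa => j /andP[_ jk]; rewrite /contraction.
have jn := leq_ltn_trans jk kn.
by rewrite !ltn_eqF // ltnS ltnW.
Qed.

Lemma mantissa_contraction_eq n f : 0 < n ->
  mantissa (contraction theta n f) n = (mantissa f n).+1.
Proof.
case: n => // n _ /=; rewrite mantissa_contraction_lt //.
by rewrite /contraction eqxx addnA addn1.
Qed.

(** The [theta n] units taken from place [n.+1] weigh as much as the unit added at place [n], so the
    surplus seen at index [n] has disappeared from [n.+1] on. *)
Lemma mantissa_contraction_gt n f k : contraction_applicable theta n f ->
  n < k -> mantissa (contraction theta n f) k = mantissa f k.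
Proof.
case/andP=> n0 tf; elim: k => // k IHk; rewrite ltnS leq_eqVlt => /orP[/eqP <-|nk] /=.
  rewrite mantissa_contraction_eq // /contraction eqxx gtn_eqF //; nia.
by rewrite IHk // /contraction !gtn_eqF // ltnW.
Qed.

Lemma mantissa_contraction_ge n f k : contraction_applicable theta n f ->
  mantissa f k <= mantissa (contraction theta n f) k.
Proof.
move=> nf; have /andP[n0 _] := nf.
have [kn|nk|->] := ltngtP k n.
- by rewrite mantissa_contraction_lt.
- by rewrite mantissa_contraction_gt.
- by rewrite mantissa_contraction_eq.
Qed.

Lemma mantissa_contractions_ge s f k : contractions_applicable theta s f ->
  mantissa f k <= mantissa (contractions theta s f) k.
Proof.
elim: s f => //= n s IHs f /andP[nf /IHs].
exact: leq_trans (mantissa_contraction_ge k nf).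
Qed.

(** A finite sequence touches finitely many places. This is the form in which contractions preserve
    the sum of the series. *)
Lemma mantissa_contractions_eventually s f : contractions_applicable theta s f ->
  exists M, forall k, M <= k ->
    mantissa (contractions theta s f) k = mantissa f k.
Proof.
elim: s f => [|n s IHs] f /=; first by exists 0.
case/andP=> nf /IHs[M HM]; exists (maxn M n.+1) => k.
by rewrite geq_max => /andP[Mk nk]; rewrite HM // mantissa_contraction_gt.
Qed.

Lemma contractions_cat s t f :
  contractions theta (s ++ t) f = contractions theta t (contractions theta s f).
Proof. by elim: s f => //=. Qed.

Lemma contractions_applicable_cat s t f :
  contractions_applicable theta (s ++ t) f =
  contractions_applicable theta s f
  && contractions_applicable theta t (contractions theta s f).
Proof. by elim: s f => //= n s IHs f; rewrite IHs andbA. Qed.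

Lemma contractions0 s f :
  contractions_applicable theta s f -> contractions theta s f 0 = f 0.
Proof.
elim: s f => //= n s IHs f /andP[/andP[n0 _] /IHs ->].
by rewrite /contraction [0 == n]ltn_eqF.
Qed.

Definition carried (n : nat) (f g : nat -> nat) : Prop :=
  [/\ g n.+1 < theta n, (forall k, n.+1 < k -> g k = f k) &
      mantissa g n.+1 = mantissa f n.+1].

(** Contraction at the same [n] is repeated until it no longer applies; each round lowers the digit
    at [n.+1], which gives the induction. *)
Lemma carry n f : 0 < n ->
  exists s, contractions_applicable theta s f /\
            carried n f (contractions theta s f).
Proof.
move=> n0; have [m] := ubnP (f n.+1); elim: m f => // m IHm f fm.
have [tf|ft] := leqP (theta n) (f n.+1); last by exists [::].
have nf : contraction_applicable theta n f by rewrite /contraction_applicable n0.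
have [|s [sf [H1 H2 H3]]] := IHm (contraction theta n f).
  rewrite /contraction eqxx gtn_eqF //; have := theta_gt0 n0; lia.
exists (n :: s) => /=; split; first by rewrite nf.
split=> // [k nk|]; last by rewrite -(mantissa_contraction_gt nf (ltnSn n)).
by rewrite H2 // /contraction !gtn_eqF // ltnW.
Qed.

(** Carrying proceeds from place [M] down to place 2. A carry out of a place changes only that place
    and the one before it, so places already reduced stay reduced. Place 1 absorbs the last carry
    and remains unbounded. *)
Lemma normalize M f :
  exists s, contractions_applicable theta s f /\
    let g := contractions theta s f in
    [/\ (forall n, 0 < n < M -> g n.+1 < theta n), mantissa g M = mantissa f M &
        forall k, M < k -> g k = f k].
Proof.
elim: M f => [|[|M] IHM] f; first by exists [::]; split=> //; split=> // n; case: n.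
  by exists [::]; split=> //; split=> // -[|[]].
have [s [sf [c1 c2 c3]]] := @carry M.+1 f isT.
have [t [tf [n1 n2 n3]]] := IHM (contractions theta s f).
exists (s ++ t); rewrite contractions_applicable_cat sf tf contractions_cat.
split=> //; split=> [n||k Mk].
- case/andP=> n0; rewrite ltnS leq_eqVlt => /orP[/eqP ->|nM].
    by rewrite n3.
  by apply: n1; rewrite n0.
- by rewrite -c3 mantissaS n2 n3.
- by rewrite n3 ?c2 // ltnW.
Qed.

(* Uniqueness of Euclidean division, from the last digit upwards. *)
Lemma mantissa_inj N g h :
  (forall n, 0 < n < N -> g n.+1 < theta n) ->
  (forall n, 0 < n < N -> h n.+1 < theta n) ->
  mantissa g N = mantissa h N -> forall k, 0 < k <= N -> g k = h k.
Proof.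
elim: N => [|N IHN] gN hN e k; first by case: k.
case: N => [|N] in IHN gN hN e *.
  by case: k => [|[]] // _; move: e; rewrite /= !muln0 !add0n.
have gb : g N.+2 < theta N.+1 by apply: gN; rewrite /= leqnn.
have hb : h N.+2 < theta N.+1 by apply: hN; rewrite /= leqnn.
have [em ed] : mantissa g N.+1 = mantissa h N.+1 /\ g N.+2 = h N.+2.
  move: e; rewrite (mantissaS g) (mantissaS h) => e; split.
    have := congr1 (divn^~ (theta N.+1)) e.
    by rewrite ![theta N.+1 * _]mulnC !divnMDl ?theta_gt0 // !divn_small // !addn0.
  have := congr1 (modn^~ (theta N.+1)) e.
  by rewrite ![theta N.+1 * _]mulnC !modnMDl !modn_small.
case/andP=> k0; rewrite leq_eqVlt => /orP[/eqP -> //|kN].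
apply: (IHN _ _ em); rewrite ?k0 // => n /andP[n0 nN].
  by apply: gN; rewrite n0 ltnW.
by apply: hN; rewrite n0 ltnW.
Qed.

End Contractions.

(** * Sums of mixed-radix series in an ordered field of reals *)

Section Values.
Context {R : realType} {theta : nat -> nat}.
Hypothesis theta_ge2 : system_function theta.
Local Open Scope ring_scope.

Local Notation mant := (mantissa theta).
Local Notation rdx n := (radix theta n)%:R.

Definition partial_sum (f : nat -> nat) (n : nat) : R := (mant f n)%:R / rdx n.

(** One extra unit in the last place makes room for any tail of bounded digits. *)
Definition upper_sum (f : nat -> nat) (n : nat) : R := (mant f n).+1%:R / rdx n.

(** Partial sums are non-decreasing, so this is convergence to [x] in the form of a supremum. A
    divergent series has no value. *)
Definition has_value (f : nat -> nat) (x : R) : Prop :=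
  (forall n, partial_sum f n <= x) /\
  (forall e, 0 < e -> exists n, x - e < partial_sum f n).

Lemma rdx_gt0 n : 0 < rdx n :> R.
Proof. by rewrite ltr0n radix_gt0. Qed.

Lemma scale_radix n k : (0 < n)%N ->
  (theta n * k)%:R / rdx n.+1 = k%:R / rdx n :> R.
Proof.
move=> n0; rewrite radixS // [(radix theta n * _)%N]mulnC !natrM -mulf_div divff ?mul1r //.
by rewrite pnatr_eq0 -lt0n theta_gt0.
Qed.

Lemma partial_sum0 f : partial_sum f 0 = 0.
Proof. by rewrite /partial_sum mul0r. Qed.

Lemma partial_sumS f n :
  partial_sum f n.+1 = partial_sum f n + (f n.+1)%:R / rdx n.+1.
Proof.
rewrite /partial_sum mantissaS natrD mulrDl; congr (_ + _).
case: n => [|n]; first by rewrite muln0 !mul0r.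
exact: scale_radix.
Qed.

Lemma partial_sum_mono f m n : (m <= n)%N -> partial_sum f m <= partial_sum f n.
Proof.
elim: n => [|n IHn]; first by rewrite leqn0 => /eqP ->.
rewrite leq_eqVlt => /orP[/eqP -> //|/IHn mn].
by rewrite partial_sumS ler_wpDr // divr_ge0 ?ler0n.
Qed.

Lemma partial_sum_ge0 f n : 0 <= partial_sum f n.
Proof. by rewrite -(partial_sum0 f) partial_sum_mono. Qed.

Lemma eq_partial_sum f g n : (forall k, (0 < k)%N -> f k = g k) ->
  partial_sum f n = partial_sum g n.
Proof.
by move=> fg; rewrite /partial_sum (@eq_mantissa theta f g) // => k /andP[/fg].
Qed.

Lemma partial_sumD f g h n : (forall k, (0 < k)%N -> f k = g k + h k)%N ->
  partial_sum f n = partial_sum g n + partial_sum h n.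
Proof.
move=> fgh; elim: n => [|n IHn]; first by rewrite !partial_sum0 addr0.
by rewrite !partial_sumS IHn fgh // natrD mulrDl addrACA.
Qed.

Lemma le_partial_sum f g n : (forall k, (0 < k)%N -> f k <= g k)%N ->
  partial_sum f n <= partial_sum g n.
Proof.
move=> fg; rewrite (@partial_sumD g f (fun k => g k - f k)%N).
  by rewrite lerDl partial_sum_ge0.
by move=> k /fg; lia.
Qed.

Lemma partial_sum_constant f N : (forall k, (N < k)%N -> f k = 0%N) ->
  forall n, (N <= n)%N -> partial_sum f n = partial_sum f N.
Proof.
move=> f0; elim=> [|n IHn]; first by rewrite leqn0 => /eqP ->.
rewrite leq_eqVlt => /orP[/eqP -> //|Nn].
by rewrite partial_sumS IHn // f0 // mul0r addr0.
Qed.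

Lemma upper_sumE f n : upper_sum f n = partial_sum f n + (rdx n)^-1.
Proof. by rewrite /upper_sum /partial_sum -addn1 natrD mulrDl div1r. Qed.

Lemma partial_lt_upper f n : partial_sum f n < upper_sum f n.
Proof. by rewrite upper_sumE ltrDl invr_gt0 rdx_gt0. Qed.

(** A digit below [theta n] together with one more unit of its own place makes up at most one unit
    of the preceding place, and exactly one if the digit is maximal. The equality case is what
    distinguishes primary from secondary expansions. *)
Lemma upper_sum_step f n : (0 < n)%N -> (f n.+1 < theta n)%N ->
  upper_sum f n.+1 <= upper_sum f n ?= iff (f n.+1 == theta n - 1)%N.
Proof.
move=> n0 fn; have t0 := theta_gt0 theta_ge2 n0.
have E : upper_sum f n = (theta n * (mant f n).+1)%:R / rdx n.+1.
  by rewrite scale_radix.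
have V0 : (rdx n.+1)^-1 != 0 :> R by rewrite invr_neq0 // gt_eqF // rdx_gt0.
split.
  rewrite E /upper_sum ler_pM2r ?invr_gt0 ?rdx_gt0 // ler_nat mantissaS; nia.
rewrite E /upper_sum (inj_eq (mulIf V0)) eqr_nat mantissaS.
by apply/eqP/eqP; nia.
Qed.

Lemma upper_sum_anti f N : (forall n, (0 < n < N)%N -> (f n.+1 < theta n)%N) ->
  forall m n, (0 < m)%N -> (m <= n)%N -> (n <= N)%N -> upper_sum f n <= upper_sum f m.
Proof.
move=> fN m n m0; elim: n => [|n IHn]; first by rewrite leqNgt m0.
rewrite leq_eqVlt => /orP[/eqP -> //|mn] nN.
have n0 : (0 < n)%N by exact: leq_trans m0 mn.
rewrite (le_trans _ (IHn mn (ltnW nN))) //.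
by have [] := upper_sum_step n0 (fN n _); rewrite // n0.
Qed.

Lemma radix_archimedean (e : R) : 0 < e ->
  exists N, forall n, (N <= n)%N -> (rdx n)^-1 < e.
Proof.
move=> e0; exists (Num.bound e^-1) => n Nn.
have e1 : 0 <= e^-1 by rewrite invr_ge0 ltW.
rewrite invf_plt ?posrE ?rdx_gt0 //; apply: lt_le_trans (archi_boundP e1) _.
by rewrite ler_nat (leq_trans Nn) // leq_radix.
Qed.

Lemma has_value_ge0 f x : has_value f x -> 0 <= x.
Proof. by move=> [fx _]; rewrite -(partial_sum0 f). Qed.

Lemma has_value_le f g x y : has_value f x -> has_value g y ->
  (forall n, exists m, partial_sum f n <= partial_sum g m) -> x <= y.
Proof.
move=> [_ fx] [gy _] fg; rewrite leNgt; apply/negP => yx.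
have [n fn] := fx (x - y) ltac:(by rewrite subr_gt0).
by have [m fm] := fg n; have := gy m; lra.
Qed.

Lemma has_value_unique f x y : has_value f x -> has_value f y -> x = y.
Proof.
by move=> fx fy; apply/le_anti/andP; split; apply: has_value_le; eauto.
Qed.

Lemma has_value_mono f g x y : has_value f x -> has_value g y ->
  (forall k, (0 < k)%N -> f k <= g k)%N -> x <= y.
Proof.
by move=> fx gy fg; apply: (has_value_le fx gy) => n; exists n; apply: le_partial_sum.
Qed.

Lemma has_value_transfer f g x : has_value f x ->
  (forall n, exists m, partial_sum f n <= partial_sum g m) ->
  (forall n, exists m, partial_sum g n <= partial_sum f m) -> has_value g x.
Proof.
move=> [fx xf] fg gf; split=> [n|e /xf[n fn]].
  by have [m /le_trans ->] := gf n.
by have [m gm] := fg n; exists m; apply: lt_le_trans gm.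
Qed.

Lemma eq_has_value f g x : has_value f x ->
  (forall k, (0 < k)%N -> f k = g k) -> has_value g x.
Proof.
move=> fx fg; apply: (has_value_transfer fx) => n; exists n.
  by rewrite (@eq_partial_sum f g).
by rewrite (@eq_partial_sum f g).
Qed.

Lemma has_value_finite f N : (forall k, (N < k)%N -> f k = 0%N) ->
  has_value f (partial_sum f N).
Proof.
move=> f0; split=> [n|e e0]; last by exists N; rewrite ltrBlDr ltrDl.
have [Nn|/ltnW nN] := leqP N n; last exact: partial_sum_mono.
by rewrite (partial_sum_constant f0).
Qed.

Lemma has_value_zero f : (forall k, (0 < k)%N -> f k = 0%N) -> has_value f 0.
Proof. by move=> f0; rewrite -(partial_sum0 f); apply: has_value_finite. Qed.

Lemma has_value_eq0 f : has_value f 0 -> forall k, (0 < k)%N -> f k = 0%N.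
Proof.
move=> [f0 _] [|k] // _; have := f0 k.+1.
rewrite partial_sumS => h; have : (f k.+1)%:R / rdx k.+1 <= 0 :> R.
  by have := partial_sum_ge0 f k; lra.
by rewrite pmulr_lle0 ?invr_gt0 ?rdx_gt0 // lern0 => /eqP.
Qed.

Lemma has_valueD f g h x y : has_value g x -> has_value h y ->
  (forall k, (0 < k)%N -> f k = g k + h k)%N -> has_value f (x + y).
Proof.
move=> [gx xg] [hy yh] fgh; split=> [n|e e0].
  by rewrite (partial_sumD _ fgh) lerD.
have e20 : 0 < e / 2 by lra.
have [n gn] := xg _ e20; have [m hm] := yh _ e20.
exists (maxn n m); rewrite (partial_sumD _ fgh).
have := partial_sum_mono g (leq_maxl n m).
by have := partial_sum_mono h (leq_maxr n m); lra.
Qed.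

Lemma has_valueB f g h x y : has_value f x -> has_value g y ->
  (forall k, (0 < k)%N -> f k = g k + h k)%N -> has_value h (x - y).
Proof.
move=> [fx xf] [gy yg] fgh; have D n := partial_sumD n fgh.
split=> [n|e /xf[n fn]]; last by exists n; have := gy n; have := D n; lra.
rewrite leNgt; apply/negP => hn.
(* Once [g] is this close to [y], the partial sum of [f] at the larger of the two indices exceeds
   [x]. *)
have [m gm] := yg (partial_sum h n - (x - y)) ltac:(lra).
have := partial_sum_mono h (leq_maxl n m); have := partial_sum_mono g (leq_maxr n m).
by have := fx (maxn n m); rewrite D; lra.
Qed.

(* The mantissas of the expansion of [x] are the integer parts of [x * radix n]. *)
Lemma primary_expansion (x : R) (e : nat) : 0 <= x ->
  exists h, [/\ primary theta h, has_value h x & h 0%N = e].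
Proof.
move=> x0; pose q n := if n is 0 then 0%N else Num.trunc (x * rdx n).
pose h n := if n is m.+1 then (q m.+1 - theta m * q m)%N else e.
have qP n : (0 < n)%N -> (q n)%:R / rdx n <= x < (q n).+1%:R / rdx n.
  case: n => // n _; rewrite ler_pdivrMr ?ltr_pdivlMr ?rdx_gt0 //.
  by apply: truncn_itv; rewrite mulr_ge0 // ler0n.
have qS n : (0 < n)%N -> (theta n * q n <= q n.+1 < theta n * (q n).+1)%N.
  move=> n0; have /andP[l1 u1] := qP n n0; have /andP[l2 u2] := qP n.+1 isT.
  rewrite -!(ltr_nat R) -ltnS -(ltr_nat R).
  have v0 : 0 < (rdx n.+1)^-1 :> R by rewrite invr_gt0 rdx_gt0.
  rewrite -(ltr_pM2r v0) -[X in _ && X](ltr_pM2r v0) !scale_radix //.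
  by rewrite (le_lt_trans l1 u2) (le_lt_trans l2 u1).
have hq n : mant h n = q n.
  elim: n => [//|n IHn]; rewrite mantissaS IHn /h.
  by case: n {IHn} => [|n]; [rewrite muln0 subn0|rewrite subnKC //; case/andP: (qS n.+1 isT)].
have psE n : (0 < n)%N -> partial_sum h n <= x < upper_sum h n.
  by rewrite /partial_sum /upper_sum hq; apply: qP.
have hlt n : (0 < n)%N -> (h n.+1 < theta n)%N.
  by move=> /qS /andP[] /=; lia.
exists h; split=> //; last first.
  split=> [[|n]|d /radix_archimedean[N HN]]; first by rewrite partial_sum0.
    by have /andP[] := psE n.+1 isT.
  exists N.+1; have := HN N.+1 (leqnSn _); have /andP[_] := psE N.+1 isT.
  by rewrite upper_sumE; lra.
split=> [[|[|k]]// _|N N0]; first exact: hlt.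
(* If all digits after [N] were maximal, the upper sums would be constant from [N] on; they lie
   strictly above [x] but come arbitrarily close to it. *)
apply: contrapT => nM; have hmax n : (N <= n)%N -> h n.+1 = (theta n - 1)%N.
  by move=> Nn; apply: contrapT => hn; apply: nM; exists n.+1.
have cst n : (N <= n)%N -> upper_sum h n = upper_sum h N.
  elim: n => [|n IHn]; first by rewrite leqn0 => /eqP ->.
  rewrite leq_eqVlt => /orP[/eqP -> //|Nn]; rewrite -IHn //.
  have n0 : (0 < n)%N by apply: leq_trans N0 Nn.
  by have [_] := upper_sum_step n0 (hlt n n0); rewrite hmax // eqxx => /eqP.
have /andP[_ xN] := psE N N0.
have [K HK] := @radix_archimedean (upper_sum h N - x) ltac:(by rewrite subr_gt0).
have := HK _ (leq_maxl K N); have /andP[] := psE _ (leq_trans N0 (leq_maxr K N)).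
by rewrite -(cst _ (leq_maxr K N)) upper_sumE; lra.
Qed.

End Values.

(** * Contracting towards primary and secondary auxiliary functions *)

Section BaseSet.
Context {R : realType} {theta : nat -> nat}.
Hypothesis theta_ge2 : system_function theta.
Local Open Scope ring_scope.
Local Open Scope classical_set_scope.

Local Notation psum := (@partial_sum R theta).
Local Notation usum := (@upper_sum R theta).
Local Notation value := (@has_value R theta).
Local Notation rdx n := (radix theta n)%:R.

Definition contracts_to (f h : nat -> nat) (N : nat) : Prop :=
  exists s, contractions_applicable theta s f /\
            forall n, (n <= N)%N -> contractions theta s f n = h n.

(** Contractions leave mantissas far out unchanged, so each partial sum of [h] is bounded by a later
    one of [f]. They never lower a mantissa, so each partial sum of [f] is bounded by the one of [h]
    at the same index. *)
Lemma contracts_to_value f h x : (forall N, (0 < N)%N -> contracts_to f h N) ->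
  value h x -> value f x /\ f 0%N = h 0%N.
Proof.
move=> fh hx; split; last first.
  by have [s [sf <-//]] := fh 1%N isT; rewrite contractions0.
have E s n N : (n <= N)%N -> (forall n, (n <= N)%N -> contractions theta s f n = h n) ->
    mantissa theta h n = mantissa theta (contractions theta s f) n.
  move=> nN sh; apply: eq_mantissa => k /andP[_ kn]; rewrite sh //.
  exact: leq_trans nN.
apply: (has_value_transfer hx) => n; have [s [sf sh]] := fh n.+1 isT.
  have [M HM] := mantissa_contractions_eventually sf.
  exists (maxn n M); set g := contractions theta s f in HM.
  have -> : psum h n = psum g n by rewrite /partial_sum (E s _ _ (leqnSn n) sh).
  have <- : psum g (maxn n M) = psum f (maxn n M) by rewrite /partial_sum HM ?leq_maxr.
  by rewrite partial_sum_mono ?leq_maxl.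
exists n; rewrite /partial_sum (E s _ _ (leqnSn n) sh).
rewrite ler_pM2r ?invr_gt0 ?rdx_gt0 // ler_nat.
exact: mantissa_contractions_ge.
Qed.

(** Let [g] be [f] normalized up to a far place [K]. The partial sum of [f] at [K] lies in the
    half-open intervals from [partial_sum] to [upper_sum] at [N] of both [g] and [h]. Such an
    interval determines its mantissa, and the mantissa determines the digits. *)
Lemma contracts_to_sandwich f h N M : bounded_digits theta h -> f 0%N = h 0%N ->
  (0 < N)%N -> psum h N <= psum f M -> (forall k, psum f k < usum h N) ->
  contracts_to f h N.
Proof.
move=> hb f0 N0 hf fh; pose K := maxn N M.
have [s [sf [g1 g2 g3]]] := normalize theta_ge2 K f.
set g := contractions theta s f in g1 g2 g3.
have NK : (N <= K)%N by exact: leq_maxl.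
have gb : forall n, (0 < n < N)%N -> (g n.+1 < theta n)%N.
  by move=> n /andP[n0 nN]; apply: g1; rewrite n0 (leq_trans nN).
have gf : psum g K = psum f K by rewrite /partial_sum g2.
have l1 : psum g N <= psum f K by rewrite -gf partial_sum_mono.
have l2 : psum f K < usum g N.
  rewrite -gf; apply: lt_le_trans (partial_lt_upper theta_ge2 _ _) _.
  exact: (upper_sum_anti theta_ge2 g1).
have l3 : psum h N <= psum f K.
  exact: le_trans hf (partial_sum_mono theta_ge2 _ (leq_maxr _ _)).
have lt_of a b : psum a N < usum b N -> (mantissa theta a N <= mantissa theta b N)%N.
  by rewrite /partial_sum /upper_sum ltr_pM2r ?invr_gt0 ?rdx_gt0 // ltr_nat ltnS.
have e : mantissa theta g N = mantissa theta h N.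
  apply/eqP; rewrite eqn_leq (lt_of _ _ (le_lt_trans l1 (fh K))).
  by rewrite (lt_of _ _ (le_lt_trans l3 l2)).
exists s; split=> // -[|k] kN; first by rewrite contractions0.
apply: (mantissa_inj theta_ge2 gb _ e); rewrite ?kN //.
by case=> // n _; apply: hb.
Qed.

Lemma value_upper h x N : bounded_digits theta h -> value h x -> (0 < N)%N ->
  x <= usum h N.
Proof.
move=> hb [_ xh] N0; rewrite leNgt; apply/negP => ux.
have [n] := xh (x - usum h N) ltac:(by rewrite subr_gt0).
have := partial_sum_mono (R := R) theta_ge2 h (leq_maxl n N).
have := partial_lt_upper (R := R) theta_ge2 h (maxn n N).
have : usum h (maxn n N) <= usum h N.
  apply: (@upper_sum_anti R _ theta_ge2 h (maxn n N)); rewrite ?leq_maxr //.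
  by case=> // k _; apply: hb.
lra.
Qed.

(** Some digit after place [N] is not maximal, and there the upper sum drops strictly. *)
Lemma primary_value_upper h x N : primary theta h -> value h x -> (0 < N)%N ->
  x < usum h N.
Proof.
move=> [hb hM] hx N0; have [M [NM hm]] := hM N N0; case: M NM hm => // m Nm hm.
have m0 : (0 < m)%N by exact: leq_trans N0 Nm.
have hb' n : (0 < n)%N -> (h n.+1 < theta n)%N by case: n => // n _; apply: hb.
apply: le_lt_trans (value_upper hb hx (ltn0Sn m)) _.
have le1 : usum h m <= usum h N.
  by apply: (upper_sum_anti theta_ge2 _ N0 Nm (leqnn m)) => n /andP[/hb'].
apply: lt_le_trans le1; have [le2 eq2] := upper_sum_step (R := R) theta_ge2 m0 (hb' m m0).
by rewrite lt_neqAle le2 eq2 andbT; apply/eqP.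
Qed.

Lemma value_attained f x N : value f x -> psum f N = x ->
  forall k, (N < k)%N -> f k = 0%N.
Proof.
move=> [fx _] fN [|k] // Nk; have := fx k.+1.
rewrite partial_sumS // => h; have : (f k.+1)%:R / rdx k.+1 <= 0 :> R.
  by have := partial_sum_mono (R := R) theta_ge2 f (Nk : (N <= k)%N); lra.
by rewrite pmulr_lle0 ?invr_gt0 ?rdx_gt0 // lern0 => /eqP.
Qed.

Lemma value_lt_psum f x N k : value f x -> (N < k)%N -> (0 < f k)%N ->
  psum f N < x.
Proof.
move=> fx Nk fk; rewrite lt_neqAle fx.1 andbT; apply/eqP => fN.
by move: fk; rewrite (value_attained fx fN).
Qed.

Lemma primary_has_value h : primary theta h -> exists x, value h x.
Proof.
move=> [hb _]; pose E := range (psum h).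
(* The bound starts at index 1 because the digit at place 1 is unrestricted, so [upper_sum h 0] need
   not bound anything. *)
have ubE : ubound E (usum h 1).
  move=> _ [n _ <-]; apply: le_trans (partial_sum_mono theta_ge2 _ (leq_maxl n 1)) _.
  apply: le_trans (ltW (partial_lt_upper theta_ge2 _ _)) _.
  apply: (@upper_sum_anti R _ theta_ge2 h (maxn n 1)); rewrite ?leq_maxr //.
  by case=> // k _; apply: hb.
have supE : has_sup E by split; [exists (psum h 0), 0%N | exists (usum h 1)].
exists (sup E); split=> [n|e e0]; first by apply: (ub_le_sup supE.2); exists n.
by have [_ [n _ <-] ?] := sup_adherent e0 supE; exists n.
Qed.

(** If [h] attains [x] at a finite stage, a partial sum of [f] must attain it too, since otherwise
    none would reach that of [h]. If [h] does not attain [x], convergence of [f] is enough. *)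
Lemma contracts_to_primary f h x : primary theta h -> value h x -> value f x ->
  f 0%N = h 0%N -> (forall n, psum h n = x -> exists m, psum f m = x) ->
  forall N, (0 < N)%N -> contracts_to f h N.
Proof.
move=> hp hx fx f0 att N N0.
have [M hM] : exists M, psum h N <= psum f M.
  have [hN|hN] := eqVneq (psum h N) x.
    by have [m fm] := att _ hN; exists m; rewrite hN fm.
  have lt : psum h N < x by rewrite lt_neqAle hN hx.1.
  have [M fM] := fx.2 (x - psum h N) ltac:(by rewrite subr_gt0).
  by exists M; lra.
apply: (contracts_to_sandwich hp.1 f0 N0 hM) => k.
exact: le_lt_trans (fx.1 k) (primary_value_upper hp hx N0).
Qed.

(** The maximal digits in the tail of [h] are positive because [theta] is at least 2, so the partial
    sums of [h] stay strictly below [x] and those of [f] overtake them. As [f] never attains [x], it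
    also stays strictly below the upper sums of [h]. *)
Lemma contracts_to_secondary f h x : secondary theta h -> value h x ->
  value f x -> f 0%N = h 0%N -> (forall m, psum f m <> x) ->
  forall N, (0 < N)%N -> contracts_to f h N.
Proof.
move=> [hb [K [K0 hK]]] hx fx f0 natt N N0.
have hN : psum h N < x.
  apply: (value_lt_psum hx (_ : N < (maxn K N).+1)%N); first by rewrite ltnS leq_maxr.
  rewrite hK ?ltnS ?leq_maxl //=.
  by have := @theta_ge2 (maxn K N); rewrite leq_max K0 => /(_ isT); lia.
have [M fM] := fx.2 (x - psum h N) ltac:(by rewrite subr_gt0).
apply: (contracts_to_sandwich hb f0 N0 (_ : _ <= psum f M)); first by lra.
move=> k; apply: lt_le_trans (value_upper hb hx N0).
by rewrite lt_neqAle fx.1 andbT; apply/eqP.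
Qed.

(** * Base elements and the fibres of sign and value *)

Definition signed_value (s : nat) (x : R) : set (nat -> nat) :=
  [set f | value f x /\ sgn f = s].

(** Equivalence in the base set fixes only the parity at place 0, while contractions preserve the
    entry there. A target for [f] therefore has to be given exactly the entry [f 0]. *)
Definition with0 (e : nat) (f : nat -> nat) (k : nat) : nat :=
  if k is 0 then e else f k.

(** The two components relate like 0.5 and 0.4999... in decimal notation: the maximal tail of [p.2]
    makes up the unit by which [p.1] is larger at its last nonzero place. *)
Lemma W1_value p : W1 theta p ->
  exists x, [/\ 0 < x, value p.1 x, value p.2 x, (exists n, psum p.1 n = x) &
                p.1 0%N = p.2 0%N].
Proof.
case=> p1 p2 [M [[M0 mx _] e1 eN z]].
case: M => // N in M0 mx e1 eN z *; have px := has_value_finite (R := R) theta_ge2 z.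
have lt0 : (0 < p.1 N.+1)%N by rewrite eN addn1.
(* The mantissas differ by exactly one from place [N.+1] on: the lead becomes [theta n] at the next
   place, where the maximal digit of [p.2] takes back all but one. *)
have pS n : (N.+1 <= n)%N -> psum p.1 n = usum p.2 n.
  move=> Nn; rewrite /partial_sum /upper_sum; congr (_%:R / _).
  elim: n Nn => // n IHn; rewrite ltnS leq_eqVlt => /orP[/eqP Nn|Nn].
    rewrite -Nn !mantissaS eN addn1 addnS; congr (_ * _ + _).+1%N.
    apply: eq_mantissa => k /andP[_ kN]; apply: e1.
    exact: leq_ltn_trans kN _.
  rewrite !mantissaS IHn // z ?ltnS // mx ?ltnS //.
  have := theta_gt0 theta_ge2 (leq_trans (ltn0Sn N) Nn); rewrite /= mulnS. lia.
exists (psum p.1 N.+1); split=> //; last 2 first.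
- by exists N.+1.
- exact: e1.
- apply: le_lt_trans (partial_sum_ge0 theta_ge2 _ N) _.
  exact: value_lt_psum px (ltnSn N) lt0.
have c n : psum p.2 n < psum p.1 (maxn n N.+1).
  rewrite pS ?leq_maxr //; apply: le_lt_trans (partial_lt_upper theta_ge2 _ _).
  by rewrite partial_sum_mono ?leq_maxl.
split=> [n|e /(radix_archimedean theta_ge2)[K HK]].
  by rewrite (le_trans (ltW (c n))) // px.1.
exists (maxn K N.+1); have := HK _ (leq_maxl K N.+1).
have := pS _ (leq_maxr K N.+1); rewrite upper_sumE //.
have := partial_sum_constant theta_ge2 z (leq_maxr K N.+1) (R := R).
by move=> ->; lra.
Qed.

Lemma primary_with0 e h : primary theta h -> primary theta (with0 e h).
Proof.
move=> [hb hN]; split=> [[|[|k]] //|N /hN[M [NM HM]]]; first exact: hb.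
by exists M; case: M NM HM.
Qed.

Lemma W1_with0 e p : W1 theta p -> W1 theta (with0 e p.1, with0 e p.2).
Proof.
case=> p1 [p2b [K [K0 HK]]] [N [[N0 mx mn] e1 eN z]].
split=> /=; first exact: primary_with0.
  split=> [[|[|k]] //|]; first exact: p2b.
  by exists K; split=> // -[|M] // KM; apply: HK.
exists N; split=> [|[|k] // /e1 //||[|k] // /z //]; last by case: (N) N0 eN.
split=> // [[|M] // /mx //|N' N'0 HN']; apply: mn => // M.
by case: M => // M /HN'.
Qed.

Lemma base_F_value p : W1 theta p -> exists2 x, 0 < x &
  real_of_base theta
    [set h | exists q, [/\ W1 theta q, base_equiv p.1 q.1 & h = q.1 \/ h = q.2]]
  = signed_value (sgn p.1) x.
Proof.
move=> pW; have [x [x0 p1x p2x [n pn] p0]] := W1_value pW; exists x => //.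
apply/seteqP; split=> f.
  case=> h [q [qW [eq1 es] hq]] fh.
  have [y [y0 q1y q2y _ q0]] := W1_value qW.
  have yx : y = x.
    apply: (has_value_unique q1y); apply: (eq_has_value p1x) => k k0.
    exact: eq1.
  have [fx f0] : value f x /\ f 0%N = q.1 0%N.
    by rewrite -yx; case: hq fh => -> /contracts_to_value; [move=> /(_ _ q1y)|rewrite q0; move=> /(_ _ q2y)].
  by split=> //; rewrite /sgn f0 -[LHS]/(sgn q.1).
case=> fx fs; pose q := (with0 (f 0%N) p.1, with0 (f 0%N) p.2).
have qW : W1 theta q by exact: W1_with0.
have [q1p [q2s _]] : primary theta q.1 /\ secondary theta q.2 /\ True by case: qW.
have wx g : value g x -> value (with0 (f 0%N) g) x.
  by move=> gx; apply: (eq_has_value gx) => -[].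
have pq : base_equiv p.1 q.1 by split; [case|rewrite -fs].
(* Whether [f] attains its sum decides which component of the pair it contracts to. *)
have [[m fm]|nfm] := pselect (exists m, psum f m = x).
  exists q.1; first by exists q; split=> //; left.
  by apply: (contracts_to_primary q1p (wx _ p1x) fx) => // _ _; exists m.
exists q.2; first by exists q; split=> //; right.
apply: (contracts_to_secondary q2s (wx _ p2x) fx) => // m fm.
by apply: nfm; exists m.
Qed.

(* 0.d1...dN and 0.d1...(dN - 1) followed by maximal digits form a pair of [W1]. *)
Lemma W1_of_finite h N : primary theta h -> (0 < h N.+1)%N ->
  (forall k, (N.+1 < k)%N -> h k = 0%N) -> exists g, W1 theta (h, g).
Proof.
move=> [hb hp] hN z; pose g k := if (k < N.+1)%N then h k
  else if k == N.+1 then (h k).-1 else (theta k.-1 - 1)%N.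
have gb : bounded_digits theta g.
  move=> k k2; rewrite /g; have := hb k k2; have : (0 < k.-1)%N by lia.
  by move/(theta_gt0 theta_ge2) => t0 hk; case: ifP => // _; case: eqP => _; lia.
have gmax : maximal_after theta g N.+1.
  by move=> M NM; rewrite /g ltnNge (ltnW NM) /= gtn_eqF.
exists g; split=> //=; first by split=> //; exists N.+1.
exists N.+1; split=> [|k kN||k /z //].
(* Minimality: if the digit of [g] at [N.+1] were maximal, the digit of [h] there would be
   [theta N], against its bound. *)
- split=> // N' N'0 gN'; rewrite leqNgt; apply/negP => N'N.
  have := gN' _ N'N; rewrite /g ltnn eqxx => e.
  have := hb N.+1 ltac:(lia); rewrite /= in e *; lia.
- by rewrite /g kN.
- by rewrite /g ltnn eqxx addn1 prednK.
Qed.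

(** A last nonzero digit at a positive place would make [h] the first component of a pair in
    [W1]. *)
Lemma W2_finite h N : W2 theta h -> (forall k, (N < k)%N -> h k = 0%N) ->
  forall k, (0 < k)%N -> h k = 0%N.
Proof.
move=> [hp hW]; elim: N => // N IHN z; apply: IHN => k.
rewrite leq_eqVlt => /orP[/eqP <-|/z //]; apply: contrapT => hN.
have [|g gW] := W1_of_finite hp _ z; first by lia.
by apply: hW; exists (h, g); split=> //; left.
Qed.

Lemma W2_with0 e h : W2 theta h -> W2 theta (with0 e h).
Proof.
move=> [hp hW]; split; first exact: primary_with0.
move=> [p [/(W1_with0 (h 0%N)) pW hq]]; apply: hW.
exists (with0 (h 0%N) p.1, with0 (h 0%N) p.2); split=> //=.
by case: hq => <-; [left|right]; apply/funext => -[].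
Qed.

Lemma base_G2_value h : W2 theta h -> exists2 x, value h x &
  real_of_base theta [set h' | W2 theta h' /\ base_equiv h h']
  = signed_value (sgn h) x.
Proof.
move=> hW; have [x hx] := primary_has_value hW.1; exists x => //.
apply/seteqP; split=> f.
  case=> g [gW [hg hgs]] fg.
  have [fx f0] := contracts_to_value fg (eq_has_value hx hg).
  by split=> //; rewrite /sgn f0 -[LHS]/(sgn g).
case=> fx fs; pose g := with0 (f 0%N) h.
have gx : value g x by apply: (eq_has_value hx) => -[].
have gW : W2 theta g by exact: W2_with0.
exists g; first by split=> //; split; [case|rewrite -fs].
(* If [g] attains its sum it is finite, hence zero on positive places by [W2_finite]; the sum is
   then 0, which [f] attains at index 0. *)
apply: (contracts_to_primary gW.1 gx fx) => // n gn.
exists 0%N; rewrite partial_sum0; apply: (has_value_unique _ gx).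
apply: (has_value_zero theta_ge2); exact: W2_finite gW (value_attained gx gn).
Qed.

Lemma sgn_le1 f : (sgn f <= 1)%N.
Proof. by rewrite /sgn; case: odd. Qed.

(** The clause for [x = 0] describes [b] itself and not just its real number; it serves to recognize
    [b1] and [b2]. *)
Lemma base_value b : base theta b -> exists s x,
  [/\ (s <= 1)%N, 0 <= x, real_of_base theta b = signed_value s x &
   x = 0 -> b = [set h | [/\ W2 theta h, (forall k, (0 < k)%N -> h k = 0%N) & sgn h = s]]].
Proof.
case=> [[p pW ->]|[h hW ->]].
  have [x x0 E] := base_F_value pW; exists (sgn p.1), x.
  by split=> //; [exact: sgn_le1|exact: ltW|move=> e; rewrite e ltxx in x0].
have [x hx E] := base_G2_value hW; exists (sgn h), x.
split=> //; [exact: sgn_le1|exact: has_value_ge0 hx|move=> e].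
rewrite {}e in hx; have h0 := has_value_eq0 theta_ge2 hx.
apply/seteqP; split=> g.
  by case=> gW [hg hgs]; split=> // k k0; rewrite -hg // h0.
by case=> gW g0 gs; split=> //; split=> // k k0; rewrite h0 // g0.
Qed.

Lemma signed_value_inj s x t y f :
  signed_value s x f -> signed_value t y f -> s = t /\ x = y.
Proof.
by move=> [fx <-] [fy <-]; split=> //; apply: (has_value_unique fx fy).
Qed.

Lemma base_sub_real b h : b h -> real_of_base theta b h.
Proof. by move=> bh; exists h => // N _; exists [::]. Qed.

Lemma primary_in_base h : primary theta h -> exists2 b, base theta b & b h.
Proof.
move=> hp; have [[p [pW hpp]]|nW] := pselect (exists p, W1 theta p /\ (h = p.1 \/ h = p.2)).
  exists [set h | exists q, [/\ W1 theta q, base_equiv p.1 q.1 & h = q.1 \/ h = q.2]].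
    by left; exists p.
  by exists p.
have hW : W2 theta h by split.
by exists [set h' | W2 theta h' /\ base_equiv h h']; [right; exists h|].
Qed.

Lemma signed_value_base s x : (s <= 1)%N -> 0 <= x ->
  exists2 b, base theta b & real_of_base theta b = signed_value s x.
Proof.
move=> s1 x0; have [h [hp hx h0]] := primary_expansion theta_ge2 (1 - s) x0.
have [b bB bh] := primary_in_base hp; exists b => //.
have [t [y [_ _ E _]]] := base_value bB; have := base_sub_real bh; rewrite E.
have hs : signed_value s x h by split=> //; rewrite /sgn h0; case: s s1 {h0} => [|[]].
by move=> /(signed_value_inj hs)[-> ->].
Qed.

Lemma base_elt_zero h : primary theta h -> (forall k, (0 < k)%N -> h k = 0%N) ->
  base theta (base_elt theta h) /\
  real_of_base theta (base_elt theta h) = signed_value (sgn h) 0.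
Proof.
move=> hp h0; rewrite /base_elt.
have [bB bh] : [set b | base theta b /\ b h]
    (xget set0 [set b | base theta b /\ b h]).
  by apply: xgetPex; have [b bB bh] := primary_in_base hp; exists b.
split=> //; have [s [x [_ _ E _]]] := base_value bB.
have := base_sub_real bh; rewrite E.
have hs : signed_value (sgn h) 0 h by split=> //; exact: (has_value_zero theta_ge2).
by move=> /(signed_value_inj hs)[-> ->].
Qed.

Lemma primary_zero h : (forall k, (0 < k)%N -> h k = 0%N) -> primary theta h.
Proof.
move=> h0; split=> [[|[|k]] // _|N N0]; first by rewrite h0 // theta_gt0.
exists N.+1; split=> //; rewrite h0 //=; have := theta_ge2 N0; lia.
Qed.

Lemma b1_value : base theta (b1 theta) /\
  real_of_base theta (b1 theta) = signed_value 1 0.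
Proof. exact: (base_elt_zero (primary_zero _)). Qed.

Lemma b2_value : base theta (b2 theta) /\
  real_of_base theta (b2 theta) = signed_value 0 0.
Proof. by apply: (base_elt_zero (primary_zero _)) => -[]. Qed.

(** [reals] excludes [b1] and [b2] as sets. This lemma turns the exclusion into one of the value 0,
    since for each sign only one base element has that value. *)
Lemma base_zero_inj b c s : base theta b -> base theta c ->
  real_of_base theta b = signed_value s 0 ->
  real_of_base theta c = signed_value s 0 -> b = c.
Proof.
have char d : base theta d -> real_of_base theta d = signed_value s 0 -> (s <= 1)%N ->
    d = [set h | [/\ W2 theta h, (forall k, (0 < k)%N -> h k = 0%N) & sgn h = s]].
  move=> dB Ed s1; have [t [x [_ _ E dE]]] := base_value dB.
  have [h [hp hx h0]] := primary_expansion theta_ge2 (1 - s) (lexx (0 : R)).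
  have hs : signed_value s 0 h by split=> //; rewrite /sgn h0; case: s s1 {h0 Ed} => [|[]].
  have := hs; rewrite -Ed E => /(signed_value_inj hs)[-> x0]; exact: dE.
(* For [s] above 1 the fibre is empty, whereas the real number of a base element is not. *)
move=> bB cB Eb Ec; have [s1|s1] := leqP s 1; first by rewrite (char b) // (char c).
have [t [x [t1 x0 E _]]] := base_value bB.
have [h [hp hx h0]] := primary_expansion theta_ge2 (1 - t) x0.
have ht : signed_value t x h by split=> //; rewrite /sgn h0; case: (t) t1 => [|[]].
by have := ht; rewrite -E Eb => -[_ hs]; move: s1; rewrite -hs ltnNge sgn_le1.
Qed.

End BaseSet.

(** * The bijection between the constructed reals and the ordered field *)

Section SignedReals.
Context {R : realType} {theta : nat -> nat}.
Hypothesis theta_ge2 : system_function theta.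
Local Open Scope ring_scope.
Local Open Scope classical_set_scope.

Local Notation value := (@has_value R theta).
Local Notation real0 := Defs.real0.
Local Notation sval := (@signed_value R theta).

(** At [z = 0] both sign conditions are vacuous, so the set contains functions of either parity, as
    [real0] does. *)
Definition signed_real (z : R) : set (nat -> nat) :=
  [set f | [/\ value f `|z|, (0 < z -> sgn f = 1%N) & (z < 0 -> sgn f = 0%N)]].

Lemma signed_real_neq0 z : z != 0 ->
  signed_real z = sval (0 < z)%R `|z|.
Proof.
move=> z0; apply/seteqP; split=> f; have [lz|gz|e] := ltgtP z 0.
- by case=> fz _ /(_ lz).
- by case=> fz /(_ gz).
- by rewrite e eqxx in z0.
- by case=> fz fs; split=> //; rewrite ltNge (ltW lz).
- by case=> fz fs; split=> //; rewrite ltNge (ltW gz).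
- by rewrite e eqxx in z0.
Qed.

Lemma sgn_signed z f : z != 0 -> signed_real z f -> sgn f = (0 < z).
Proof. by move=> z0; rewrite signed_real_neq0 // => -[]. Qed.

Lemma signed_real0 :
  signed_real 0 = sval 1 0 `|` sval 0 0.
Proof.
apply/seteqP; split=> f; rewrite /signed_real /= normr0 ltxx.
  case=> fx _ _; have := sgn_le1 f; rewrite leq_eqVlt ltnS leqn0.
  by case/orP=> /eqP fs; [left|right].
by case=> -[].
Qed.

Lemma real0_signed : real0 theta = signed_real 0.
Proof.
by rewrite /real0 signed_real0 (@b1_value R _ theta_ge2).2 (@b2_value R _ theta_ge2).2.
Qed.

Lemma signed_real_of_base s x : (s <= 1)%N -> x != 0 -> 0 <= x ->
  exists2 z, z != 0 & sval s x = signed_real z.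
Proof.
move=> s1 x0 x_ge0; have xgt : 0 < x by rewrite lt_neqAle eq_sym x0.
case: s s1 => [|[]] // _; [exists (- x)|exists x]; rewrite ?oppr_eq0 //;
  rewrite signed_real_neq0 ?oppr_eq0 // ?normrN ger0_norm //.
  by rewrite oppr_gt0 ltNge x_ge0.
by rewrite xgt.
Qed.

Lemma reals_signed x : reals theta x -> exists z, x = signed_real z.
Proof.
case=> [[b [bB b1 b2 ->]]|->]; last by exists 0; exact: real0_signed.
have [s [x' [s1 x0 E _]]] := base_value (R := R) theta_ge2 bB.
have [e|x'0] := eqVneq x' 0; last first.
  by have [z _ Ez] := signed_real_of_base s1 x'0 x0; exists z; rewrite E.
(* A base element of value 0 is [b2] or [b1] according to its sign, and both are excluded here. *)
rewrite {}e in E; case: s s1 E => [|[]] // _ E.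
  by case: b2; apply: (base_zero_inj theta_ge2 bB _ E); case: (b2_value (R := R) theta_ge2).
by case: b1; apply: (base_zero_inj theta_ge2 bB _ E); case: (b1_value (R := R) theta_ge2).
Qed.

Lemma signed_real_inj y z f : signed_real y f -> signed_real z f -> y = z.
Proof.
case=> fy y1 y2 [fz z1 z2]; have e : `|y| = `|z| by apply: has_value_unique fy fz.
have [ly|gy|ey] := ltgtP y 0; have [lz|gz|ez] := ltgtP z 0.
- by move: e; rewrite !ltr0_norm // => /oppr_inj.
- by have := y2 ly; rewrite z1.
- by move: e; rewrite ez normr0 => /eqP; rewrite normr_eq0 => /eqP.
- by have := z2 lz; rewrite y1.
- by move: e; rewrite !gtr0_norm.
- by move: e; rewrite ez normr0 => /eqP; rewrite normr_eq0 => /eqP.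
- by move: e; rewrite ey normr0 => /esym/eqP; rewrite normr_eq0 => /eqP.
- by move: e; rewrite ey normr0 => /esym/eqP; rewrite normr_eq0 => /eqP.
- by rewrite ey ez.
Qed.

Lemma signed_real_primary z : exists2 h, primary theta h & signed_real z h.
Proof.
have [h [hp hz h0]] := primary_expansion theta_ge2 (~~ (0 < z)%R) (normr_ge0 z).
exists h => //; split=> //; rewrite /sgn h0; first by move=> ->.
by move=> lz; rewrite ltNge (ltW lz).
Qed.

Lemma signed_real_injective y z : signed_real y = signed_real z -> y = z.
Proof.
by move=> e; have [h _ hy] := signed_real_primary y; apply: (signed_real_inj hy); rewrite -e.
Qed.

Lemma real0_neq z : signed_real z <> real0 theta <-> z != 0.
Proof.
rewrite real0_signed; split=> [h|/eqP h /signed_real_injective //].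
by apply/eqP => e; apply: h; rewrite e.
Qed.

Lemma signed_real_reals z : reals theta (signed_real z).
Proof.
have [->|z0] := eqVneq z 0; first by right; rewrite real0_signed.
left; have s1 : (((0 < z)%R : nat) <= 1)%N by case: (0 < z).
have [b bB bE] := signed_value_base theta_ge2 s1 (normr_ge0 z).
(* If [b] were [b1] or [b2], then [zero_fun] or [one_at0] would lie in [signed_real z] and force
   [z = 0]. *)
exists b; rewrite bE signed_real_neq0 //; split=> // e; move: bE; rewrite e.
  rewrite (@b1_value R _ theta_ge2).2 -signed_real_neq0 // => E.
  have [h _ hz] := signed_real_primary 0; case/eqP: z0.
  have : signed_real z zero_fun by rewrite -E; split=> //; apply: has_value_zero.
  move/signed_real_inj; apply; split; rewrite ?ltxx // normr0; exact: has_value_zero.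
rewrite (@b2_value R _ theta_ge2).2 -signed_real_neq0 // => E; case/eqP: z0.
have o : value one_at0 0 by apply: has_value_zero => // -[].
have : signed_real z one_at0 by rewrite -E; split.
by move/signed_real_inj; apply; split; rewrite ?ltxx // normr0.
Qed.

Lemma signed_real_unique x z f : reals theta x -> x f -> signed_real z f ->
  x = signed_real z.
Proof. by move=> /reals_signed[y ->] /signed_real_inj yz /yz ->. Qed.

Lemma class_of_signed z f : signed_real z f -> class_of theta f = signed_real z.
Proof.
move=> fz; apply: xget_unique => [|x [xR xf]]; last exact: signed_real_unique fz.
by split=> //; apply: signed_real_reals.
Qed.

Lemma sgn_real_signed z : z != 0 -> sgn_real (signed_real z) = (0 < z).
Proof.
move=> z0; rewrite signed_real_neq0 //; apply: xget_unique => [|_ [f [_ fs] <-] //].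
have [h _] := signed_real_primary z; rewrite signed_real_neq0 // => hz.
by exists h => //; case: hz.
Qed.

(** * The order, and the dominating functions that witness it *)

Lemma value_extend f x y (e : nat) : value f x -> x <= y -> exists g,
  [/\ value g y, g 0%N = e & forall n, (0 < n)%N -> (f n <= g n)%N].
Proof.
rewrite -subr_ge0 => fx /(primary_expansion theta_ge2 e)[h [_ hd h0]].
exists (fun k => if k is 0 then h 0%N else f k + h k)%N; split=> //.
  by rewrite -(subrKC x y); apply: (has_valueD theta_ge2 fx hd) => -[].
by case=> // n _; rewrite leq_addr.
Qed.

Lemma signed_real_witness z f : value f `|z| -> sgn f = (0 < z) -> signed_real z f.
Proof. by move=> fz fs; split=> // z0; rewrite fs ?z0 // ltNge ltW. Qed.

(** Digitwise domination implies an inequality of values. Conversely, any representative of the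
    smaller absolute value is dominated by one of the larger, by adding an expansion of the
    difference. For negative numbers the roles are exchanged. *)
Lemma real_le_signed y z : real_le theta (signed_real y) (signed_real z) <-> y <= z.
Proof.
split.
  case=> [[/real0_neq y0 /real0_neq z0]|[/real0_neq y0 + ]|[+ /real0_neq z0]|[]].
  - rewrite !sgn_real_signed //; case.
    + have [//|y0'] := ltP 0 y; first by case: (0 < z).
      by have [z0' _|//] := ltP 0 z; apply: le_trans y0' (ltW z0').
    + case; case: (ltP 0 y) => // yp _; case: (ltP 0 z) => // zp _ H.
      have [f _ fy] := signed_real_primary y; have [g [gz fg]] := H f fy.
      have [fv _ _] := fy; have [gv _ _] := gz.
      by have := has_value_mono theta_ge2 fv gv fg; rewrite !gtr0_norm.
    + case; case: (ltP 0 y) => // yn _; case: (ltP 0 z) => // zn _ H.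
      have [g _ gz] := signed_real_primary z; have [f [fy fg]] := H g gz.
      have [fv _ _] := fy; have [gv _ _] := gz.
      have := has_value_mono theta_ge2 gv fv fg.
      by rewrite !ler0_norm // lerN2.
  - rewrite real0_signed sgn_real_signed // => /signed_real_injective ->.
    by case: ltP.
  - rewrite real0_signed sgn_real_signed // => /signed_real_injective ->.
    by case: ltP => // /ltW.
  - by rewrite real0_signed => /signed_real_injective -> /signed_real_injective ->.
have [->|y0] := eqVneq y 0; have [->|z0] := eqVneq z 0.
- by move=> _; apply: Or44; rewrite real0_signed.
- move=> zp; apply: Or43; split; rewrite ?real0_signed //.
    by rewrite -real0_signed; apply/real0_neq.
  by rewrite sgn_real_signed // lt_neqAle eq_sym z0 zp.
- move=> yn; apply: Or42; split; rewrite ?real0_signed //.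
    by rewrite -real0_signed; apply/real0_neq.
  by rewrite sgn_real_signed // ltNge yn.
move=> yz; apply: Or41; split; [exact/real0_neq|exact/real0_neq|].
rewrite !sgn_real_signed //; have [yp|yn] := ltP 0 y.
  have zp : 0 < z by exact: lt_le_trans yz.
  rewrite zp; apply: Or32; split=> // f [fv _ _].
  have le : `|y| <= `|z| by rewrite !gtr0_norm.
  have [g [gv g0 fg]] := value_extend 0 fv le.
  by exists g; split=> //; apply: signed_real_witness; rewrite // /sgn g0 zp.
have [zp|zn] := ltP 0 z; first exact: Or31.
apply: Or33; split=> // g [gv _ _].
have le : `|z| <= `|y| by rewrite !ler0_norm // lerN2.
have [f [fv f0 gf]] := value_extend 1 gv le.
exists f; split=> //; apply: signed_real_witness; rewrite // /sgn f0 /=.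
by rewrite ltNge yn.
Qed.

(** * Absolute values, tracking functions and addition *)

Lemma abs_fun_signed z f : signed_real z f -> signed_real `|z| (abs_fun f).
Proof.
case=> fz _ _; split=> //; last by rewrite ltNge normr_ge0.
by rewrite normr_id; apply: (eq_has_value fz) => -[].
Qed.

Lemma real_abs_signed z : real_abs theta (signed_real z) = signed_real `|z|.
Proof.
have E f : signed_real z f -> class_of theta (abs_fun f) = signed_real `|z|.
  by move/abs_fun_signed/class_of_signed.
apply: xget_unique => [|_ [f /E + <-] //].
by have [f _ fz] := signed_real_primary z; exists f => //; exact: E.
Qed.

Section Tracking.
Variables (y z : R) (f g : nat -> nat).
Hypotheses (fy : signed_real y f) (gz : signed_real z g) (zy : `|z| < `|y|).

Let y_neq0 : y != 0.
Proof. by rewrite -normr_gt0; apply: le_lt_trans zy. Qed.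

(** This is [y + z] when [y] and [z] have opposite signs or [z = 0], the cases in which [sub_sum]
    uses tracking. *)
Let t := Num.sg y * (`|y| - `|z|).

Let norm_t : `|t| = `|y| - `|z|.
Proof.
by rewrite normrM normr_sg y_neq0 mul1r ger0_norm // subr_ge0 ltW.
Qed.

Let t_neq0 : t != 0.
Proof. by rewrite -normr_gt0 norm_t subr_gt0. Qed.

Let t_gt0 : (0 < t) = (0 < y).
Proof. by rewrite pmulr_lgt0 ?subr_gt0 // sgr_gt0. Qed.

Lemma tracking_signed : tracking theta f g `<=` signed_real t.
Proof.
move=> r [w []]; rewrite (class_of_signed fy) signed_real_neq0 // => -[wy ws] gw r0 rw.
have [gv _ _] := gz.
rewrite signed_real_neq0 // norm_t t_gt0; split; last by rewrite -ws /sgn r0.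
by apply: (has_valueB theta_ge2 wy gv) => k k0; rewrite rw // subnKC // gw.
Qed.

Lemma tracking_neq0 : exists r, tracking theta f g r.
Proof.
have [gv _ _] := gz; have [w [wv w0 gw]] := value_extend (~~ (0 < y)%R) gv (ltW zy).
exists (fun k => if k is 0 then w 0%N else w k - g k)%N; exists w; split=> //.
  rewrite (class_of_signed fy); apply: signed_real_witness => //.
  by rewrite /sgn w0; case: (0 < y).
by case.
Qed.

Lemma primary_tracking_signed : signed_real t (primary_tracking theta f g).
Proof.
rewrite /primary_tracking; set x := xget _ _.
(* Reals are disjoint, so the non-empty set of tracking functions lies in only one of them. *)
have -> : x = signed_real t.
  apply: xget_unique => [|x' [x'R tx']].
    by split; [exact: signed_real_reals|exact: tracking_signed].
  have [r rt] := tracking_neq0.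
  by apply: signed_real_unique (tx' _ rt) (tracking_signed rt).
have [hv _] : (signed_real t `&` primary theta) (primary_repr theta (signed_real t)).
  by apply: xgetPex; have [h hp ht] := signed_real_primary t; exists h.
rewrite signed_real_neq0 // in hv *; case: hv => hv _; split.
  by apply: (eq_has_value hv) => -[].
have := fy; rewrite signed_real_neq0 // => -[_].
by rewrite t_gt0 /sgn /=.
Qed.

End Tracking.

Lemma real0_signedP z f : signed_real z f -> real0 theta f <-> z = 0.
Proof.
move=> fz; rewrite real0_signed; split; first exact: signed_real_inj.
by move=> <-.
Qed.

Lemma sub_sum_signed y z f g : signed_real y f -> signed_real z g ->
  signed_real (y + z) (sub_sum theta f g).
Proof.
move=> fy gz; rewrite /sub_sum (class_of_signed fy) (class_of_signed gz).
rewrite !real_abs_signed; have [fv _ _] := fy; have [gv _ _] := gz.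
case: asboolP => [[s /(real0_signedP fy)/eqP y0 /(real0_signedP gz)/eqP z0]|H].
  have ss := s; rewrite (sgn_signed y0 fy) (sgn_signed z0 gz) in ss.
  have n : `|y + z| = `|y| + `|z|.
    move: ss; have [yp|yn] := ltP 0 y; have [zp|zn] := ltP 0 z => // _.
      by rewrite !gtr0_norm // addr_gt0.
    have yz : y + z <= 0 by lra.
    by rewrite !ler0_norm ?opprD.
  have yzp : (0 < y + z) = (0 < y).
    move: ss y0 z0; have [yp|yn] := ltP 0 y; have [zp|zn] := ltP 0 z => // _ _ _.
      by rewrite addr_gt0.
    by apply/negbTE; rewrite -leNgt; lra.
  apply: signed_real_witness.
    by rewrite n; apply: (has_valueD theta_ge2 fv gv) => -[].
  (* A product of two entries of equal parity has that same parity, so the sign is kept. *)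
  rewrite yzp -(sgn_signed y0 fy); move: s; rewrite /sgn /= oddM.
  by do 2!case: odd.
(* Outside the first branch a summand vanishes or the signs are opposite, so the sum is a difference
   of absolute values up to sign. *)
have yz : y = 0 \/ z = 0 \/ (0 < y) && (z < 0) \/ (y < 0) && (0 < z).
  have [->|y0] := eqVneq y 0; first by left.
  have [->|z0] := eqVneq z 0; first by right; left.
  do 2!right; have : sgn f <> sgn g.
    by move=> s; apply: H; split=> // [/(real0_signedP fy)|/(real0_signedP gz)]; exact/eqP.
  rewrite (sgn_signed y0 fy) (sgn_signed z0 gz).
  have [yp|yn|e] := ltgtP y 0; have [zp|zn|e'] := ltgtP z 0 => // _;
    by [left|right|case/eqP: y0|case/eqP: z0].
case: asboolP => [/signed_real_injective nyz|nyz].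
  have -> : y + z = 0.
    case: yz => [e|[e|[/andP[a b]|/andP[a b]]]].
    - by move: nyz; rewrite e normr0 add0r => /esym/eqP; rewrite normr_eq0 => /eqP.
    - by move: nyz; rewrite e normr0 addr0 => /eqP; rewrite normr_eq0 => /eqP.
    - by move: nyz; rewrite gtr0_norm // ltr0_norm // => ->; rewrite addNr.
    - by move: nyz; rewrite ltr0_norm // gtr0_norm // => <-; rewrite addrN.
  by split=> //; rewrite ?ltxx // normr0; apply: has_value_zero.
have {}nyz : `|y| != `|z| by apply/eqP => e; apply: nyz; rewrite e.
case: asboolP => [/real_le_signed/negP|/contrapT/real_le_signed yz'].
  rewrite -ltNge => zy; have := primary_tracking_signed fy gz zy.
  suff -> : y + z = Num.sg y * (`|y| - `|z|) by [].
  rewrite mulrBr -numEsg; case: yz => [e|[->|[/andP[a b]|/andP[a b]]]].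
  - by move: zy; rewrite e normr0 normr_lt0.
  - by rewrite normr0 mulr0 subr0 addr0.
  - by rewrite gtr0_sg // mul1r ltr0_norm // opprK.
  - by rewrite ltr0_sg // mulN1r opprK gtr0_norm.
have {yz'}yz' : `|y| < `|z| by rewrite lt_neqAle nyz.
have := primary_tracking_signed gz fy yz'.
suff -> : y + z = Num.sg z * (`|z| - `|y|) by [].
rewrite mulrBr -numEsg addrC; case: yz => [->|[e|[/andP[a b]|/andP[a b]]]].
- by rewrite normr0 mulr0 subr0 addr0.
- by move: yz'; rewrite e normr0 normr_lt0.
- by rewrite ltr0_sg // mulN1r opprK gtr0_norm.
- by rewrite gtr0_sg // mul1r ltr0_norm // opprK.
Qed.

Lemma real_add_signed y z :
  real_add theta (signed_real y) (signed_real z) = signed_real (y + z).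
Proof.
have E f g : signed_real y f -> signed_real z g ->
    class_of theta (sub_sum theta f g) = signed_real (y + z).
  by move=> fy gz; apply/class_of_signed/sub_sum_signed.
apply: xget_unique => [|_ [f fy [g gz <-]]]; last exact: E.
have [f _ fy] := signed_real_primary y; have [g _ gz] := signed_real_primary z.
by exists f => //; exists g => //; exact: E.
Qed.

End SignedReals.

Theorem mainTheorem10 (theta : nat -> nat) (htheta : system_function theta)
    (a b c : set (nat -> nat))
    (ha : reals theta a) (hb : reals theta b) (hc : reals theta c)
    (hab : real_le theta a b) :
  real_le theta (real_add theta a c) (real_add theta b c).
Proof.
(* The preceding sections work over any [realType]; the reals of the standard library provide an
   instance. *)
have [x Ex] := reals_signed (R := Rdefinitions.R) htheta ha.
have [y Ey] := reals_signed (R := Rdefinitions.R) htheta hb.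
have [z Ez] := reals_signed (R := Rdefinitions.R) htheta hc.
subst a b c; rewrite !(real_add_signed htheta) in hab *.
by apply/(real_le_signed htheta); rewrite lerD2r; apply/(real_le_signed htheta).
Qed.
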